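(* Let $p,q\ge0$ be integers and let $a_1,\dots,a_p,b_1,\dots,b_q$ be nonzero complex numbers with no $b_i$ a nonpositive integer. The hypergeometric coefficient $$c(n)=\frac{(a_1)_{n-1}\cdots(a_p)_{n-1}}{(b_1)_{n-1}\cdots(b_q)_{n-1}}\qquad(n\ge1)$$ is a completely multiplicative function of $n$ if and only if it is of the form $Cn^a$ for some $a\in\mathbb{Z}$ and $C\in\mathbb{C}$.
   Context: The ascending factorial is $(c)_k=c(c+1)\cdots(c+k-1)$, $(c)_0=1$. A function $c$ on the positive integers is completely multiplicative if $c(nk)=c(n)c(k)$ for all $n,k\ge1$. *)

(* Defs.v *)
From mathcomp Require Import all_boot all_order all_algebra.
From mathcomp Require Import reals.
From mathcomp Require Import complex.

Set Implicit Arguments.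
Unset Strict Implicit.
Unset Printing Implicit Defensive.

Import GRing.Theory Num.Theory.

Local Open Scope ring_scope.

Definition ascfact (K : pzSemiRingType) (c : K) (k : nat) : K :=
  \prod_(i < k) (c + i%:R).

(** An arithmetic function is represented by a function on [nat]; its value
    at [0] is irrelevant. *)
Definition completely_multiplicative (K : pzSemiRingType) (c : nat -> K) : Prop :=
  forall n k : nat, (0 < n)%N -> (0 < k)%N -> c (n * k)%N = c n * c k.

Definition hypergeom_coef (K : fieldType) (p q : nat)
    (a : 'I_p -> K) (b : 'I_q -> K) (n : nat) : K :=
  (\prod_(i < p) ascfact (a i) n.-1) / (\prod_(j < q) ascfact (b j) n.-1).

(* Main.v *)
Require Import Defs.
From mathcomp Require Import all_boot all_order all_algebra.
From mathcomp Require Import reals boolp zify ring.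
From mathcomp Require Import complex.

(** Put A(x) = prod_i (x - (1 - a_i)) and B(x) = prod_j (x - (1 - b_j)), so that
    c(1) = 1 and c(n+1) B(n) = c(n) A(n) for n >= 1. If c n = C n^e, then
    n = 1 gives C = 1 and multiplicativity is clear ([hypergeom_power_mul]).

    Conversely, let c be completely multiplicative. Then c never vanishes
    ([mult_rec_neq0]): c(2) is a quotient of nonzero numbers, hence c(2^k) <> 0, whereas
    a zero of c would propagate to all larger arguments. Writing
    c(k(n+1)) / c(kn) = c(n+1) / c(n) by means of the recurrence gives, for the
    rational function A/B, the identity
      prod_(j < k) (A/B)(kx + j) = (A/B)(x)
    at all positive integers x, and hence identically. Let D(z) be the order of
    A/B at z. Comparing orders at x ([divisor_dilation]),
      D(x) = sum_(j < k) D(kx + j)   for all k >= 1,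
    where D has finite support. This forces D to vanish off {0, -1} and
    D(0) + D(-1) = 0 ([dilation_eq0], [dilation_sum0]):
    - if x is an integer other than 0 and -1, then for large k all kx + j lie
      outside the support;
    - if x = u/v is rational and different from 0 and -1, the points vx + j are
      the v integers from u on, so that D(x) is D(0) + D(-1) when -1 < x < 0 and
      0 otherwise; as D(-1/N) = 0 for some N, the constant D(0) + D(-1) is 0;
    - if D(x) <> 0, then for each k some kx + j lies in the finite support, so
      that kx + j = k'x + j' with k <> k' for some choices, and x is rational.

    Since A and B are monic, A/B = ((x + 1) / x)^e with e = D(-1)
    ([factor_cross]), and c(n) = n^e by induction. *)

Set Implicit Arguments.
Unset Strict Implicit.
Unset Printing Implicit Defensive.
Import GRing.Theory Num.Theory.
Local Open Scope ring_scope.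

(** * Finitely supported functions invariant under dilation *)

Lemma injective_leaves_seq (T : eqType) (f : nat -> T) (S : seq T) :
  injective f -> exists n, f n \notin S.
Proof.
move=> f_inj; apply: contrapT => no_exit.
have subS : {subset mkseq f (size S).+1 <= S}.
  move=> _ /mapP[n _ ->]; apply: contrapT => /negP fnS.
  by apply: no_exit; exists n.
by have := uniq_leq_size (mkseq_uniq _ f_inj) subS; rewrite size_mkseq ltnn.
Qed.

Lemma seq_int_bound (K : numFieldType) (S : seq K) :
  exists M : nat, forall m : int, m%:~R \in S -> (`|m| < M)%N.
Proof.
elim: S => [|s S [M boundM]]; first by exists 0%N.
have [[m0 s_eq]|s_nint] := EM (exists m : int, s = m%:~R).
  exists (maxn M `|m0|.+1) => m; rewrite in_cons s_eq eqr_int.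
  by case/orP=> [/eqP->|/boundM]; lia.
exists M => m; rewrite in_cons => /orP[/eqP m_eq|/boundM//].
by case: s_nint; exists m.
Qed.

Section Dilation.
Variables (K : numFieldType) (D : K -> int) (S : seq K).
Hypothesis D_supp : forall z, D z != 0 -> z \in S.
Hypothesis D_dilation : forall (k : nat) (x : K), (0 < k)%N ->
  D x = \sum_(j < k) D (k%:R * x + j%:R).

Lemma dilation_int0 (m : int) : m != 0 -> m != -1 -> D m%:~R = 0.
Proof.
move=> m_neq0 m_neqN1; have [M boundM] := seq_int_bound S.
(* Each k m + j with 0 <= j < k = M + 1 has absolute value at least M. *)
rewrite (D_dilation m%:~R (ltn0Sn M)) big1 // => j _.
have -> : M.+1%:R * m%:~R + j%:R = (M.+1%:Z * m + j%:Z)%:~R :> K.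
  by rewrite intrD intrM.
apply: contrapT => /eqP/D_supp/boundM.
by have := ltn_ord j; case: (ltrP 0 m) => ?; nia.
Qed.

(** Dilating by the denominator moves x to a run of v consecutive integers
    starting at u; this run contains -1 if and only if it contains 0, unless
    x is 0 or -1. *)
Lemma dilation_rat (x : K) (v : nat) (u : int) :
    (0 < v)%N -> v%:R * x = u%:~R -> x != 0 -> x != -1 ->
  D x = if (u < 0) && (- v%:Z < u) then D 0 + D (-1) else 0.
Proof.
move=> v_gt0 vx_eq x_neq0 x_neqN1.
have v_neq0 : v%:R != 0 :> K by rewrite pnatr_eq0 -lt0n.
have u_neq0 : u != 0.
  by apply: contra_neq x_neq0 => u0; apply: (mulfI v_neq0); rewrite vx_eq u0 mulr0.
have u_neqNv : u != - v%:Z.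
  apply: contra_neq x_neqN1 => uv; apply: (mulfI v_neq0).
  by rewrite vx_eq uv mulrN1 intrN.
rewrite (D_dilation x v_gt0) vx_eq.
have -> : \sum_(j < v) D (u%:~R + j%:R) = \sum_(j < v) D (u + j%:Z)%:~R.
  by apply: eq_bigr => j _; rewrite intrD.
case: ifPn => [/andP[u_lt0 u_gtNv]|u_out].
  have lt_tv : (`|u| < v)%N by lia.
  have lt_t1v : (`|u|.-1 < v)%N by lia.
  rewrite (bigD1 (Ordinal lt_tv)) //= (bigD1 (Ordinal lt_t1v)) /=; last first.
    by rewrite -val_eqE /=; lia.
  rewrite big1 ?addr0 => [|j /andP[/eqP jt /eqP jt1]].
    have -> : u + `|u|%N = 0 by lia.
    by have -> : u + `|u|.-1%N = -1 by lia.
  have {}jt : j <> `|u|%N :> nat by move=> e; apply: jt; apply: val_inj.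
  have {}jt1 : j <> `|u|.-1 :> nat by move=> e; apply: jt1; apply: val_inj.
  by apply: dilation_int0; lia.
by rewrite big1 // => j _; apply: dilation_int0; have := ltn_ord j; lia.
Qed.

(** The value at -1/N is the same for all N >= 2, and some -1/N avoids the
    support. *)
Lemma dilation_sum0 : D 0 + D (-1) = 0.
Proof.
pose f n : K := - n.+2%:R^-1.
have [n fnS] : exists n, f n \notin S.
  apply: injective_leaves_seq => m n /oppr_inj/invr_inj/eqP.
  by rewrite eqr_nat => /eqP[].
have n2_neq0 : n.+2%:R != 0 :> K by rewrite pnatr_eq0.
have Df0 : D (f n) = 0 by apply: contrapT => /eqP/D_supp; rewrite (negPf fnS).
have fE : n.+2%:R * f n = (-1)%:~R by rewrite /f mulrN divff.
have f_neq0 : f n != 0 by rewrite oppr_eq0 invr_eq0.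
have f_neqN1 : f n != -1.
  by rewrite eqr_opp invr_eq1 pnatr_eq1.
by rewrite -Df0 (dilation_rat (ltn0Sn _) fE f_neq0 f_neqN1).
Qed.

(** By pigeonhole a point of the support is rational, and at rational points
    other than 0 and -1 the two preceding results give 0. *)
Lemma dilation_eq0 x : x != 0 -> x != -1 -> D x = 0.
Proof.
move=> x_neq0 x_neqN1; apply: contrapT => /eqP Dx_neq0.
have x_irr v u : (0 < v)%N -> v%:R * x <> u%:~R.
  move=> v_gt0 /(dilation_rat v_gt0)/(_ x_neq0 x_neqN1) Dx.
  by move: Dx_neq0; rewrite Dx dilation_sum0 if_same eqxx.
have /choice[j jS] : forall k, exists j : nat, k.+1%:R * x + j%:R \in S.
  move=> k; apply: contrapT => noj.
  move: Dx_neq0; rewrite (D_dilation x (ltn0Sn k)) big1 ?eqxx // => j _.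
  by apply: contrapT => /eqP/D_supp jS; apply: noj; exists j.
(* f k is a point of the support; f k = f l with k <> l makes x rational. *)
pose f k := k.+1%:R * x + (j k)%:R.
have f_lt k l : (k < l)%N -> f k <> f l.
  move=> lt_kl fkl; apply: (x_irr (l - k)%N ((j k)%:Z - (j l)%:Z)).
    by rewrite subn_gt0.
  rewrite natrB ?(ltnW lt_kl) // intrB.
  move: fkl; rewrite /f -!natr1 => /eqP; rewrite -subr_eq0 => /eqP fkl.
  by apply/eqP; rewrite -subr_eq0 -oppr_eq0 -fkl; apply/eqP; ring.
have [k] : exists k, f k \notin S.
  apply: injective_leaves_seq => k l.
  by case: (ltngtP k l) => // /f_lt + E; rewrite E.
by rewrite jS.
Qed.

End Dilation.

(** * Equality of products of linear factors on the positive integers *)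

Lemma horner_eq_on_pos (K : numFieldType) (P Q : {poly K}) :
  (forall n : nat, (0 < n)%N -> P.[n%:R] = Q.[n%:R]) -> P = Q.
Proof.
move=> PQ; apply/eqP; rewrite -subr_eq0; apply: contraT => PQ_neq0.
pose s : seq K := mkseq (fun n => n.+1%:R) (size (P - Q)).
have s_uniq : uniq s.
  by apply: mkseq_uniq => m n /eqP; rewrite eqr_nat => /eqP[].
have /(max_poly_roots PQ_neq0)/(_ s_uniq) : all (root (P - Q)) s.
  by apply/allP => _ /mapP[n _ ->]; rewrite rootE hornerD hornerN PQ ?subrr.
by rewrite size_mkseq ltnn.
Qed.

(** The constants l and l' are automatically equal, being leading coefficients
    of the same polynomial. *)
Lemma perm_of_eq_on_pos (K : numFieldType) (l l' : K) (s t : seq K) :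
    l != 0 ->
    (forall n : nat, (0 < n)%N ->
      l * \prod_(x <- s) (n%:R - x) = l' * \prod_(x <- t) (n%:R - x)) ->
  perm_eq s t.
Proof.
move=> l_neq0 eq_st; apply: prod_XsubC_eq.
have E : l *: \prod_(x <- s) ('X - x%:P) = l' *: \prod_(x <- t) ('X - x%:P).
  apply: horner_eq_on_pos => n n_gt0; rewrite !hornerZ !horner_prod.
  under eq_bigr do rewrite !hornerE.
  by under [in RHS]eq_bigr do rewrite !hornerE; exact: eq_st.
have := congr1 lead_coef E; rewrite !lead_coefZ !(monicP (monic_prod_XsubC _ _ _)) !mulr1.
by move=> ll'; move: E; rewrite -ll' => /(scalerI l_neq0).
Qed.

(** The roots of the product over j < k of P(kx + j), where P has the roots s. *)
Definition preimages (K : fieldType) (k : nat) (s : seq K) : seq K :=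
  [seq (x - j%:R) / k%:R | j <- iota 0 k, x <- s].

Lemma prod_preimages (K : numFieldType) (k : nat) (s : seq K) n : (0 < k)%N ->
  \prod_(j < k) \prod_(x <- s) ((k * n + j)%:R - x) =
  (k%:R ^+ size s) ^+ k * \prod_(x <- preimages k s) (n%:R - x).
Proof.
move=> k_gt0; have k_neq0 : k%:R != 0 :> K by rewrite pnatr_eq0 -lt0n.
rewrite /preimages big_allpairs_dep /= -[X in iota 0 X]subn0 -/(index_iota 0 k).
rewrite big_mkord -[in X in _ ^+ X](card_ord k) -prodr_const -big_split /=.
apply: eq_bigr => j _.
rewrite -(count_predT s) -iter_mulr_1 -big_const_seq -big_split /=; apply: eq_bigr => x _.
by rewrite natrD natrM; field.
Qed.

Lemma count_preimages (K : numFieldType) (k : nat) (s : seq K) (z : K) : (0 < k)%N ->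
  count_mem z (preimages k s) =
    (\sum_(j < k) count_mem (k%:R * z + j%:R)%R s)%N.
Proof.
move=> k_gt0; have k_neq0 : k%:R != 0 :> K by rewrite pnatr_eq0 -lt0n.
rewrite /preimages count_flatten sumnE !big_map /= -[X in iota 0 X]subn0.
rewrite -/(index_iota 0 k) big_mkord; apply: eq_bigr => j _.
rewrite count_map; apply: eq_count => x /=.
by rewrite -(inj_eq (mulIf k_neq0)) divfK // subr_eq mulrC.
Qed.

(** * Completely multiplicative solutions of c(n+1) B(n) = c(n) A(n) *)

Section Recurrence.
Variables (K : numFieldType) (c : nat -> K) (rs ss : seq K).
Let A (x : K) := \prod_(r <- rs) (x - r).
Let B (x : K) := \prod_(s <- ss) (x - s).
Hypothesis rs1 : 1 \notin rs.
Hypothesis ss_pos : forall n : nat, (0 < n)%N -> n%:R \notin ss.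
Hypothesis c1 : c 1%N = 1.
Hypothesis c_rec : forall n : nat, (0 < n)%N ->
  c n.+1 * B n%:R = c n * A n%:R.
Hypothesis c_mul : forall n k : nat, (0 < n)%N -> (0 < k)%N ->
  c (n * k)%N = c n * c k.

Lemma denominator_neq0 n : (0 < n)%N -> B n%:R != 0.
Proof.
move=> /ss_pos nS; rewrite /B prodf_seq_neq0; apply/allP => s sS /=.
by rewrite subr_eq0; apply: contraNneq nS => ->.
Qed.

(** A zero at n propagates to all larger arguments, in particular to 2^n, whereas
    c(2^n) = c(2)^n is nonzero because A(1) is. *)
Lemma mult_rec_neq0 n : (0 < n)%N -> c n != 0.
Proof.
have c2 : c 2%N != 0.
  have A1 : A 1%:R != 0.
    rewrite /A prodf_seq_neq0; apply/allP => s sS /=.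
    by rewrite subr_eq0; apply: contraNneq rs1 => e; have -> : 1 = s := e.
  have := c_rec (ltn0Sn 0); rewrite c1 mul1r => cB.
  by apply: contraNneq A1 => c20; rewrite -cB c20 mul0r.
have c2X k : c (2 ^ k)%N != 0.
  elim: k => [|k IHk]; first by rewrite c1 oner_eq0.
  by rewrite expnS c_mul ?expn_gt0 // mulf_neq0.
move=> n_gt0; apply: contraTneq (c2X n) => cn0; rewrite negbK.
have : (n <= 2 ^ n)%N by exact: ltnW (ltn_expl _ _).
elim: (2 ^ n)%N => [|m IHm]; first by lia.
rewrite leq_eqVlt => /orP[/eqP<-|]; first by rewrite cn0.
rewrite ltnS => le_nm; have m_gt0 := leq_trans n_gt0 le_nm.
have /eqP := c_rec m_gt0; rewrite (eqP (IHm le_nm)) mul0r mulf_eq0.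
by rewrite (negPf (denominator_neq0 m_gt0)) orbF.
Qed.

Lemma mult_rec_iter m n : (0 < n)%N ->
  c (n + m)%N * \prod_(j < m) B (n + j)%:R = c n * \prod_(j < m) A (n + j)%:R.
Proof.
move=> n_gt0; elim: m => [|m IHm]; first by rewrite addn0 !big_ord0.
rewrite !big_ord_recr /= mulrCA addnS c_rec ?addn_gt0 ?n_gt0 //.
by rewrite [LHS]mulrA (mulrC _ (c _)) IHm mulrA.
Qed.

(** Both sides of c(k(n+1)) / c(kn) = c(n+1) / c(n), expressed by A and B. *)
Lemma factor_dilation k n : (0 < k)%N -> (0 < n)%N ->
  A n%:R * \prod_(j < k) B (k * n + j)%:R =
  B n%:R * \prod_(j < k) A (k * n + j)%:R.
Proof.
move=> k_gt0 n_gt0.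
have kn_gt0 : (0 < k * n)%N by rewrite muln_gt0 k_gt0.
have := mult_rec_iter k kn_gt0; rewrite -mulnSr !c_mul // -!mulrA.
move=> /(mulfI (mult_rec_neq0 k_gt0)) E; apply: (mulfI (mult_rec_neq0 n_gt0)).
by rewrite mulrA -c_rec // mulrAC E -mulrA [B _ * _]mulrC.
Qed.

(** The order at z of the rational function A/B. *)
Definition divisor (z : K) : int := (count_mem z rs)%:Z - (count_mem z ss)%:Z.

Lemma divisor_dilation k x : (0 < k)%N ->
  divisor x = \sum_(j < k) divisor (k%:R * x + j%:R).
Proof.
move=> k_gt0; have k_neq0 : k%:R != 0 :> K by rewrite pnatr_eq0 -lt0n.
have /permP/(_ (pred1 x)) :
    perm_eq (rs ++ preimages k ss) (ss ++ preimages k rs).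
  apply: (perm_of_eq_on_pos (l := (k%:R ^+ size ss) ^+ k)
                            (l' := (k%:R ^+ size rs) ^+ k)) => [|n n_gt0].
    by rewrite !expf_neq0.
  rewrite !big_cat /= mulrCA [RHS]mulrCA -!prod_preimages //.
  exact: factor_dilation.
rewrite !count_cat !count_preimages // => E.
rewrite /divisor sumrB -!(big_morph Posz PoszD (erefl _)).
by apply/eqP; rewrite subr_eq addrAC eq_sym subr_eq -!PoszD eqz_nat E addnC.
Qed.

(** This is A/B = ((x + 1) / x)^e with e = D(-1), cleared of denominators so that
    the sign of e does not matter. *)
Lemma factor_cross n : (0 < n)%N ->
  A n%:R * (n.+1%:R ^+ count_mem (-1) ss * n%:R ^+ count_mem (-1) rs) =
  B n%:R * (n.+1%:R ^+ count_mem (-1) rs * n%:R ^+ count_mem (-1) ss).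
Proof.
move=> n_gt0; have D_supp z : divisor z != 0 -> z \in rs ++ ss.
  rewrite mem_cat; apply: contraNT; rewrite negb_or => /andP[zr zs].
  by rewrite /divisor !(count_memPn _).
have D0 := dilation_sum0 D_supp divisor_dilation.
have Dx := dilation_eq0 D_supp divisor_dilation.
have N1_neq0 : -1 != 0 :> K by rewrite oppr_eq0 oner_eq0.
pose a := count_mem (-1) rs; pose b := count_mem (-1) ss.
have E : perm_eq (rs ++ nseq b (-1) ++ nseq a 0)
                 (ss ++ nseq a (-1) ++ nseq b 0).
  apply/allP => z _ /=; rewrite !count_cat !count_nseq /=.
  have [->|z_neq0] := eqVneq z 0.
    move: D0; rewrite /divisor -/a -/b => D0.
    rewrite (negPf N1_neq0) !mul0n !mul1n.
    by move: D0; do 2 move: (count_mem 0 _) => ?; lia.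
  have [->|z_neqN1] := eqVneq z (-1).
    rewrite -/a -/b !mul0n !mul1n; by lia.
  by have := Dx _ z_neq0 z_neqN1; rewrite /divisor; do 2 move: (count_mem z _) => ?; lia.
have prod_perm (s t : seq K) : perm_eq s t ->
    \prod_(x <- s) (n%:R - x) = \prod_(x <- t) (n%:R - x) by exact: perm_big.
(* The added factors are n + 1 for the root -1 and n for the root 0. *)
move/prod_perm: E.
by rewrite !big_cat !big_nseq !iter_mulr_1 subr0 opprK natr1.
Qed.

(** The identity c(n) = n^e, again cleared of denominators. *)
Lemma mult_rec_power n : (0 < n)%N ->
  c n * n%:R ^+ count_mem (-1) ss = n%:R ^+ count_mem (-1) rs.
Proof.
case: n => // n _; elim: n => [|n IHn]; first by rewrite c1 !expr1n mulr1.
have Bn := denominator_neq0 (ltn0Sn n).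
have na : n.+1%:R ^+ count_mem (-1) rs != 0 :> K.
  by rewrite expf_neq0 ?pnatr_eq0.
apply: (mulfI Bn); apply: (mulIf na).
transitivity (c n.+1 * (A n.+1%:R * (n.+2%:R ^+ count_mem (-1) ss *
                                     n.+1%:R ^+ count_mem (-1) rs))).
  by rewrite [RHS]mulrA -c_rec //; ring.
by rewrite factor_cross // -IHn; ring.
Qed.

End Recurrence.

(** * Hypergeometric coefficients *)

Section Hypergeometric.
Variables (K : numFieldType) (p q : nat) (a : 'I_p -> K) (b : 'I_q -> K).

Lemma hypergeom_coef1 : hypergeom_coef a b 1 = 1.
Proof.
by rewrite /hypergeom_coef !big1 ?divr1 // => i _; rewrite /ascfact big_ord0.
Qed.

Lemma hypergeom_coefS n : (0 < n)%N ->
  hypergeom_coef a b n.+1 = hypergeom_coef a b n *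
   ((\prod_(i < p) (n%:R - (1 - a i))) / (\prod_(j < q) (n%:R - (1 - b j)))).
Proof.
have ascS (m : nat) (d : 'I_m -> K) k :
    \prod_(i < m) ascfact (d i) k.+1 =
    \prod_(i < m) ascfact (d i) k * \prod_(i < m) (k.+1%:R - (1 - d i)).
  rewrite -big_split /=; apply: eq_bigr => i _.
  by rewrite /ascfact big_ord_recr -natr1 /=; congr (_ * _); ring.
by case: n => // n _; rewrite /hypergeom_coef /= !ascS invfM mulrACA.
Qed.

Lemma hypergeom_power_mul (e : int) (C : K) :
    (forall n : nat, (0 < n)%N -> hypergeom_coef a b n = C * n%:R ^ e) ->
  completely_multiplicative (hypergeom_coef a b).
Proof.
move=> cE n k n_gt0 k_gt0.
have := cE 1%N isT; rewrite hypergeom_coef1 exp1rz mulr1 => C1.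
by rewrite !cE ?muln_gt0 ?n_gt0 // -C1 !mul1r natrM expfzMl.
Qed.

Lemma hypergeom_mul_power :
    (forall i, a i != 0) -> (forall j (m : nat), b j != - m%:R) ->
    completely_multiplicative (hypergeom_coef a b) ->
  exists e : int, forall n : nat, (0 < n)%N ->
    hypergeom_coef a b n = n%:R ^ e.
Proof.
move=> a_neq0 b_npos c_mul.
pose rs := [seq 1 - a i | i <- index_enum 'I_p].
pose ss := [seq 1 - b j | j <- index_enum 'I_q].
have rs1 : 1 \notin rs.
  apply/mapP => -[i _ /eqP].
  by rewrite -subr_eq0 opprB addrC subrK; apply/negP.
have ss_pos (n : nat) : (0 < n)%N -> n%:R \notin ss.
  case: n => // n _; apply/mapP => -[j _ /eqP].
  rewrite -natr1 addrC (inj_eq (addrI 1)) eq_sym; apply/negP.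
  by rewrite eqr_oppLR; apply: b_npos.
have c_rec (n : nat) : (0 < n)%N ->
    hypergeom_coef a b n.+1 * \prod_(s <- ss) (n%:R - s) =
    hypergeom_coef a b n * \prod_(r <- rs) (n%:R - r).
  move=> n_gt0; have := denominator_neq0 ss_pos n_gt0.
  rewrite hypergeom_coefS // !big_map => denominator_neq0.
  by rewrite -mulrA divfK.
exists ((count_mem (-1) rs)%:Z - (count_mem (-1) ss)%:Z) => n n_gt0.
have n_neq0 : n%:R != 0 :> K by rewrite pnatr_eq0 -lt0n.
have nb_neq0 : n%:R ^+ count_mem (-1) ss != 0 :> K by rewrite expf_neq0.
apply: (mulIf nb_neq0).
rewrite (mult_rec_power rs1 ss_pos hypergeom_coef1 c_rec c_mul n_gt0).
by rewrite !exprnP -expfzDr // subrK.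
Qed.

End Hypergeometric.

Theorem corollary7p2 (R : realType) (p q : nat)
    (a : 'I_p -> R[i]) (b : 'I_q -> R[i])
    (a_neq0 : forall i : 'I_p, a i <> 0)
    (b_neq0 : forall j : 'I_q, b j <> 0)
    (b_not_nonpos_int : forall (j : 'I_q) (m : nat), b j <> - m%:R) :
  completely_multiplicative (hypergeom_coef a b) <->
  exists (e : int) (C : R[i]), forall n : nat, (0 < n)%N ->
    hypergeom_coef a b n = C * n%:R ^ e.
Proof.
split=> [c_mul|[e [C cE]]]; last exact: hypergeom_power_mul cE.
have a0 i : a i != 0 by exact/eqP.
have bN j (m : nat) : b j != - m%:R by exact/eqP.
have [e cE] := hypergeom_mul_power a0 bN c_mul.
by exists e, 1 => n n_gt0; rewrite mul1r cE.
Qed.
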